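(* Let $R$ be a ring. Then the following statements are equivalent: (1) every flat left $R$-module is semi-compact; (2) $R$ is $\Sigma$-semi-compact as a left $R$-module; (3) $R$ satisfies the ascending chain condition on left annulets (equivalently, $R$ satisfies the descending chain condition on right annulets).
   Context: Rings are associative with identity and modules are unitary. For a left $R$-module $M$ and a left ideal $I$ of $R$, $M[I]=\{m\in M\mid Im=0\}$. $M$ is semi-compact if every set of congruences $x\equiv x_\alpha\pmod{M[I_\alpha]}$ ($\alpha\in\Lambda$, $x_\alpha\in M$, $I_\alpha$ a left ideal of $R$), each finite subset of which has a common solution in $M$, has a simultaneous solution in $M$. $M$ is $\Sigma$-semi-compact if all direct sums of copies of $M$ are semi-compact. A left annulet of $R$ is a left ideal of the form $\{r\in R\mid rX=0\}$, and a right annulet is a right ideal of the form $\{r\in R\mid Xr=0\}$, with $X$ a subset of $R$. *)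

(* Defs.v *)
From HB Require Import structures.
From mathcomp Require Import all_boot all_order all_algebra.
From mathcomp Require Import boolp classical_sets functions cardinality.
From mathcomp Require Import freeg.

Set Implicit Arguments.
Unset Strict Implicit.
Unset Printing Implicit Defensive.

Import GRing.Theory.
Local Open Scope classical_set_scope.
Local Open Scope ring_scope.
Local Open Scope quotient_scope.

(* Rings are [pzRingType]s, so that the zero ring is allowed.  A left
   R-module is an [lmodType R]; a right R-module is an [lmodType R^c], where
   R^c is the opposite ring, the right action of r on a being written r *: a. *)

Section Ideals.
Variable R : pzRingType.

Definition left_ideal (I : set R) : Prop :=
  [/\ I 0, forall x y, I x -> I y -> I (x + y)
    & forall r x, I x -> I (r * x)].

Definition left_annulet (L : set R) : Prop :=
  exists X : set R, L = [set r | forall x, X x -> r * x = 0].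

Definition right_annulet (L : set R) : Prop :=
  exists X : set R, L = [set r | forall x, X x -> x * r = 0].

Definition acc_left_annulets : Prop :=
  forall L : nat -> set R, (forall n, left_annulet (L n)) ->
    (forall n, L n `<=` L n.+1) ->
    exists N, forall n, (N <= n)%N -> L n = L N.

Definition dcc_right_annulets : Prop :=
  forall L : nat -> set R, (forall n, right_annulet (L n)) ->
    (forall n, L n.+1 `<=` L n) ->
    exists N, forall n, (N <= n)%N -> L n = L N.

End Ideals.

(* M[I] *)
Definition annihilated_by (R : pzRingType) (M : lmodType R) (I : set R)
    : set M :=
  [set m | forall r, I r -> r *: m = 0].
Arguments annihilated_by {R} M I.

(* x = y mod M[I] is rendered as x - y \in M[I]. *)
Definition semi_compact (R : pzRingType) (M : lmodType R) : Prop :=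
  forall (Idx : Type) (x : Idx -> M) (I : Idx -> set R),
    (forall a, left_ideal (I a)) ->
    (forall F : set Idx, finite_set F ->
       exists y : M, forall a, F a -> annihilated_by M (I a) (y - x a)) ->
    exists y : M, forall a, annihilated_by M (I a) (y - x a).

(* The direct sum M^(Idx): the submodule of finitely supported functions of
   the module Idx -> M, with pointwise operations. *)
Section DirectSum.
Variables (R : pzRingType) (Idx : Type) (M : lmodType R).

Definition finsupp : {pred Idx -> M} :=
  fun f => `[< finite_set [set i | f i <> 0] >].

Lemma finsupp_submod_closed : submod_closed finsupp.
Proof.
split=> [|r f g /asboolP ff /asboolP fg]; apply/asboolP.
  by apply: (sub_finite_set _ (finite_set0 Idx)) => i; apply.
apply: (sub_finite_set (B := [set i | f i <> 0] `|` [set i | g i <> 0])).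
  move=> i /= h; apply: contrapT => /not_orP[/contrapT fi /contrapT gi].
  by apply: h; rewrite /= [LHS](_ : _ = r *: f i + g i)// fi gi scaler0 addr0.
by rewrite finite_setU.
Qed.

HB.instance Definition _ :=
  GRing.isSubmodClosed.Build R (Idx -> M) finsupp finsupp_submod_closed.

Record direct_sum := DirectSum { dsum_fun :> Idx -> M; _ : dsum_fun \in finsupp }.

HB.instance Definition _ := [isSub for dsum_fun].
HB.instance Definition _ := [Choice of direct_sum by <:].
HB.instance Definition _ := [SubChoice_isSubLmodule of direct_sum by <:].

End DirectSum.

Definition sigma_semi_compact (R : pzRingType) (M : lmodType R) : Prop :=
  forall Idx : Type, semi_compact (direct_sum Idx M).

(* The tensor product of a right module A and a left module M: the quotient of
   the free abelian group on A * M by the subgroup generated by the bilinearity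
   and balancing relations. *)
Section Tensor.
Variables (R : pzRingType) (A : lmodType R^c) (M : lmodType R).

Inductive tensor_rel : {freeg (A * M)%type} -> Prop :=
| TensorRel0 : tensor_rel 0
| TensorRelB s t : tensor_rel s -> tensor_rel t -> tensor_rel (s - t)
| TensorRelDl (a b : A) (m : M) :
    tensor_rel (<< (a + b, m) >> - << (a, m) >> - << (b, m) >>)
| TensorRelDr (a : A) (m n : M) :
    tensor_rel (<< (a, m + n) >> - << (a, m) >> - << (a, n) >>)
| TensorRelZ (r : R) (a : A) (m : M) :
    tensor_rel (<< ((r : R^c) *: a, m) >> - << (a, r *: m) >>).

Definition tensor_null : {pred {freeg (A * M)%type}} :=
  fun s => `[< tensor_rel s >].

Lemma tensor_null_zmod_closed : zmod_closed tensor_null.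
Proof.
split=> [|s t /asboolP hs /asboolP ht]; apply/asboolP.
  exact: TensorRel0.
exact: TensorRelB.
Qed.

HB.instance Definition _ :=
  GRing.isZmodClosed.Build {freeg (A * M)%type} tensor_null
    tensor_null_zmod_closed.

Definition tensor := Quotient.quot tensor_null.

HB.instance Definition _ := ZmodQuotient.on tensor.

Definition tens (a : A) (m : M) : tensor := \pi_tensor << (a, m) >>.

Lemma tensor_pi_eq (s t : {freeg (A * M)%type}) :
  \pi_tensor s = \pi_tensor t <-> tensor_rel (s - t).
Proof.
split=> [/eqP|h]; first by rewrite -Quotient.idealrBE => /asboolP.
by apply/eqP; rewrite -Quotient.idealrBE; apply/asboolP.
Qed.

End Tensor.

(* The map f (x) M : A (x) M -> B (x) M induced by f : A -> B; the choice of
   representative is immaterial by [tensor_map_pi]. *)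
Definition freeg_map (R : pzRingType) (A B : lmodType R^c) (M : lmodType R)
    (f : {linear A -> B}) : {freeg (A * M)%type} -> {freeg (B * M)%type} :=
  fglift (fun am : A * M => << (f am.1, am.2) >>).

Definition tensor_map (R : pzRingType) (A B : lmodType R^c) (M : lmodType R)
    (f : {linear A -> B}) (t : tensor A M) : tensor B M :=
  \pi_(tensor B M) (freeg_map f (repr t)).

Section TensorMapTheory.
Variables (R : pzRingType) (A B : lmodType R^c) (M : lmodType R).
Variable f : {linear A -> B}.

Lemma freeg_mapB s t :
  freeg_map f (s - t) = freeg_map f s - freeg_map f t :> {freeg (B * M)%type}.
Proof. exact: lift_is_additive. Qed.

Lemma freeg_mapU (a : A) (m : M) : freeg_map f << (a, m) >> = << (f a, m) >>.
Proof. by rewrite /freeg_map liftU scale1r. Qed.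

Lemma freeg_map_rel (s : {freeg (A * M)%type}) :
  tensor_rel s -> tensor_rel (freeg_map f s).
Proof.
elim=> [|{}s t _ hs _ ht|a b m|a m n|r a m].
- by rewrite -(subrr 0) freeg_mapB subrr; exact: TensorRel0.
- by rewrite freeg_mapB; exact: TensorRelB.
- by rewrite !freeg_mapB !freeg_mapU raddfD; exact: TensorRelDl.
- by rewrite !freeg_mapB !freeg_mapU; exact: TensorRelDr.
- by rewrite !freeg_mapB !freeg_mapU linearZ; exact: TensorRelZ.
Qed.

Lemma tensor_map_pi (s : {freeg (A * M)%type}) :
  tensor_map f (\pi_(tensor A M) s) =
  \pi_(tensor B M) (freeg_map f s).
Proof.
apply/tensor_pi_eq; rewrite -freeg_mapB; apply: freeg_map_rel.
by apply/tensor_pi_eq; rewrite reprK.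
Qed.

Lemma tensor_map_tens (a : A) (m : M) : tensor_map f (tens a m) = tens (f a) m.
Proof. by rewrite /tens tensor_map_pi freeg_mapU. Qed.

End TensorMapTheory.

(* M is flat when the functor - (x) M preserves injectivity. *)
Definition flat (R : pzRingType) (M : lmodType R) : Prop :=
  forall (A B : lmodType R^c) (f : {linear A -> B}),
    injective f -> injective (@tensor_map R A B M f).

(* Main.v *)
Require Import Defs.
From mathcomp Require Import all_boot all_order all_algebra.
From HB Require Import structures.
From mathcomp Require Import boolp classical_sets functions cardinality.
From mathcomp Require Import freeg.

Set Implicit Arguments.
Unset Strict Implicit.
Unset Printing Implicit Defensive.

Import GRing.Theory.
Local Open Scope classical_set_scope.
Local Open Scope ring_scope.
Local Open Scope quotient_scope.

(** Write r(X) and l(X) for the right and left annihilators of X in R, and M[X]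
for the elements of M killed by X.  Semi-compactness of M follows from a
finiteness property: every subset U of R contains a finite G with M[G] <= M[U].

The maps r and l are inverse order-reversing bijections between left and right
annulets, so ACC on the former is DCC on the latter ([acc_left_dcc_right]).
Under DCC, every U contains a finite G with r(G) = r(U), namely one for which
r(G) is minimal ([dcc_finite_rann]).  Flatness transports this to modules: an
element m killed by the finite set G is a sum of elements c m' with c in r(G),
so that M[G] = r(G) M, and r(G) <= r(U) gives M[G] <= M[U]
([flat_annihilated]).  This finiteness property makes M semi-compact: take U
to be the union of the ideals of the system; the finitely many elements of G
come from finitely many congruences, and any solution of these solves all of
them ([finite_annihilators_semi_compact]).  Hence ACC implies that all flat
modules are semi-compact.

Direct sums of copies of R are flat, because an element of the tensor product
of A with R^(X) is determined by its coordinates, which are a finite family of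
elements of A ([direct_sum_flat]).  Hence semi-compactness of all flat modules
implies that R is Sigma-semi-compact.

Finally, let R be Sigma-semi-compact, let L_0 <= L_1 <= ... be left annulets and
K_n = r(L_n).  Pick k_n in K_n, outside K_(n+1) whenever possible.  In R^(nat)
the congruences x = (k_0, ..., k_(n-1), 0, ...) mod M[L_n] are finitely
solvable; a simultaneous solution has finite support, and beyond it each k_n
lies in K_(n+1), so that K_n = K_(n+1) ([sigma_semi_compact_acc]). *)

(** * Annulets and chain conditions *)

Section Annulets.
Variable R : pzRingType.
Implicit Types (X Y U L : set R) (G : seq R).

Definition lann X : set R := [set r | forall x, X x -> r * x = 0].
Definition rann X : set R := [set r | forall x, X x -> x * r = 0].

Lemma lann_anti X Y : X `<=` Y -> lann Y `<=` lann X.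
Proof. by move=> XY r Yr x /XY; apply: Yr. Qed.

Lemma rann_anti X Y : X `<=` Y -> rann Y `<=` rann X.
Proof. by move=> XY r Yr x /XY; apply: Yr. Qed.

Lemma lann_rannK L : left_annulet L -> lann (rann L) = L.
Proof.
move=> [X ->]; apply/seteqP; split=> r h x hx; last exact: hx.
by apply: h => s; apply.
Qed.

Lemma rann_lannK L : right_annulet L -> rann (lann L) = L.
Proof.
move=> [X ->]; apply/seteqP; split=> r h x hx; last exact: hx.
by apply: h => s; apply.
Qed.

Lemma left_annulet_ideal L : left_annulet L -> left_ideal L.
Proof.
move=> [X ->]; split=> [x _|r s hr hs x hx|r s hs x hx] /=.
- by rewrite mul0r.
- by rewrite mulrDl hr // hs // addr0.
- by rewrite -mulrA hs // mulr0.
Qed.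

Lemma acc_left_dcc_right : acc_left_annulets R <-> dcc_right_annulets R.
Proof.
split=> cc L La Lmon.
- have [|n|N hN] := cc (fun n => lann (L n)); first by move=> n; exists (L n).
    exact: lann_anti.
  by exists N => n /hN e; rewrite -[LHS]rann_lannK // e rann_lannK.
- have [|n|N hN] := cc (fun n => rann (L n)); first by move=> n; exists (L n).
    exact: rann_anti.
  by exists N => n /hN e; rewrite -[LHS]lann_rannK // e lann_rannK.
Qed.

(** If no finite G worked, every finite G included in U could be enlarged by an
element of U so as to shrink its right annihilator strictly; iterating from the
empty set would contradict the chain condition. *)
Lemma dcc_finite_rann U : dcc_right_annulets R ->
  exists2 G : seq R, [set` G] `<=` U & rann [set` G] `<=` rann U.
Proof.
move=> dcc; apply: contrapT => noG.
(* The premise makes [next] total, so that [choice] yields a plain function. *)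
have next G : exists u, [set` G] `<=` U ->
    U u /\ ~ (rann [set` G] `<=` rann [set u]).
  have [GU|nGU] := pselect ([set` G] `<=` U); last by exists 0.
  apply: contrapT => nou; apply: noG; exists G => // r Gr u Uu.
  apply: contrapT => ur; apply: nou; exists u => _; split=> // h.
  by apply: ur; exact: (h _ Gr u).
have [u uP] := choice next.
pose G n := iter n (fun s => u s :: s) [::].
have GU n : [set` G n] `<=` U.
  elim: n => // n IH x /=; rewrite inE => /orP[/eqP->|/IH//].
  by have [] := uP _ IH.
have [|n|N hN] := dcc (fun n => rann [set` G n]).
- by move=> n; exists [set` G n].
- by apply: rann_anti => x /= xG; rewrite inE xG orbT.
have [_] := uP _ (GU N); apply.
rewrite -(hN N.+1) // => r h x ->.
by apply: h; rewrite /= inE eqxx.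
Qed.

End Annulets.

(** * A criterion for semi-compactness *)

(** Two solutions of the finitely many congruences that supply G differ by an
element of M[G], hence of M[U], where U is the union of the ideals.  So if y
solves these, and z solves these and one further congruence, then y solves that
further congruence too. *)
Lemma finite_annihilators_semi_compact (R : pzRingType) (M : lmodType R) :
  (forall U : set R, exists2 G : seq R, [set` G] `<=` U &
     annihilated_by M [set` G] `<=` annihilated_by M U) ->
  semi_compact M.
Proof.
move=> finM Idx x I _ sol.
have [G GU annG] := finM [set r | exists a, I a r].
have [F Ffin FG] : exists2 F : set Idx, finite_set F &
    forall g, g \in G -> exists2 a, F a & I a g.
  elim: G GU {annG} => [_|g G IH GU]; first by exists set0.
  have [|F Ffin FG] := IH; first by move=> h /= hG; apply: GU; rewrite /= inE hG orbT.
  have [a Ia] : exists a, I a g by apply: GU; rewrite /= inE eqxx.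
  exists (F `|` [set a]); first by rewrite finite_setU.
  move=> h; rewrite inE => /orP[/eqP->|/FG[b Fb Ib]].
    by exists a => //; right.
  by exists b => //; left.
have [y yP] := sol F Ffin; exists y => a r Iar.
have [|z zP] := sol (F `|` [set a]); first by rewrite finite_setU.
have zy : annihilated_by M [set` G] (z - y).
  move=> g /= /FG[b Fb Ib].
  have -> : z - y = (z - x b) - (y - x b) by rewrite opprB addrA subrK.
  by rewrite scalerBr (zP b (or_introl Fb) g Ib) (yP b Fb g Ib) subrr.
have -> : y - x a = (z - x a) - (z - y) by rewrite opprB [RHS]addrC addrA subrK.
rewrite scalerBr (zP a (or_intror erefl) r Iar) (annG _ zy r); last by exists a.
by rewrite subrr.
Qed.

(** * Tensor products *)

Section Tensors.
Variables (R : pzRingType) (A : lmodType R^c) (M : lmodType R).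
Implicit Types (a b : A) (m n : M) (s t : {freeg (A * M)%type}).

Lemma pi_tensorB s t :
  \pi_(tensor A M) (s - t) = \pi_(tensor A M) s - \pi_(tensor A M) t.
Proof. by rewrite !piE. Qed.

Lemma pi_tensor_eq0 s : \pi_(tensor A M) s = 0 <-> tensor_rel s.
Proof.
have <- : \pi_(tensor A M) 0 = 0 by rewrite -(subrr 0) pi_tensorB subrr.
by rewrite tensor_pi_eq subr0.
Qed.

Lemma tensDl a b m : tens (a + b) m = tens a m + tens b m.
Proof.
apply/eqP; rewrite -subr_eq0 opprD addrA /tens -!pi_tensorB; apply/eqP.
exact/pi_tensor_eq0/TensorRelDl.
Qed.

Lemma tensDr a m n : tens a (m + n) = tens a m + tens a n.
Proof.
apply/eqP; rewrite -subr_eq0 opprD addrA /tens -!pi_tensorB; apply/eqP.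
exact/pi_tensor_eq0/TensorRelDr.
Qed.

Lemma tensZ (r : R) a m : tens ((r : R^c) *: a) m = tens a (r *: m).
Proof.
apply/eqP; rewrite -subr_eq0 /tens -!pi_tensorB; apply/eqP.
exact/pi_tensor_eq0/TensorRelZ.
Qed.

Lemma tens0l m : tens (0 : A) m = 0.
Proof. by apply: (addrI (tens 0 m)); rewrite -tensDl !addr0. Qed.

Lemma tens0r a : tens a (0 : M) = 0.
Proof. by apply: (addrI (tens a 0)); rewrite -tensDr !addr0. Qed.

Lemma tens_suml I (r : seq I) (a : I -> A) m :
  tens (\sum_(i <- r) a i) m = \sum_(i <- r) tens (a i) m.
Proof.
by elim: r => [|i r IH]; rewrite ?big_nil ?tens0l // !big_cons tensDl IH.
Qed.

Lemma tens_sumr I (r : seq I) a (m : I -> M) :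
  tens a (\sum_(i <- r) m i) = \sum_(i <- r) tens a (m i).
Proof.
by elim: r => [|i r IH]; rewrite ?big_nil ?tens0r // !big_cons tensDr IH.
Qed.

(** The free abelian group is generated by its basis: closure under differences
yields all integer combinations. *)
Lemma freeg_pure_ind (P : {freeg (A * M)%type} -> Prop) :
  P 0 -> (forall s t, P s -> P t -> P (s - t)) ->
  (forall a m, P << (a, m) >>) -> forall s, P s.
Proof.
move=> P0 PB PU.
have PN s : P s -> P (- s) by rewrite -[- s]sub0r; exact: PB.
have PD s t : P s -> P t -> P (s + t).
  by move=> hs /PN ht; rewrite -[t]opprK; exact: PB.
have PMn (n : nat) s : P s -> P (s *+ n).
  by move=> Ps; elim: n => [|n IH]; rewrite ?mulr0n // mulrS; exact: PD.
elim/freeg_ind_dom0 => // k [a m] s _ _; apply: PD.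
have -> : << k *g (a, m) >> = << (a, m) >> *~ k :> {freeg (A * M)%type}.
  by rewrite freegU_mulz intz.
by case: k => n; rewrite ?NegzE ?mulrNz -pmulrn; [|apply: PN]; apply: PMn.
Qed.

Section Lift.
Variables (V : zmodType) (g : A -> M -> V).

Definition freeg_lift s : V := fglift (fun am : A * M => g am.1 am.2 : zmodule V) s.

Lemma freeg_liftB s t : freeg_lift (s - t) = freeg_lift s - freeg_lift t.
Proof. exact: (@lift_is_additive _ _ (zmodule V)). Qed.

Lemma freeg_lift0 : freeg_lift 0 = 0.
Proof. by rewrite -[X in freeg_lift X](subrr 0) freeg_liftB subrr. Qed.

Lemma freeg_liftU a m : freeg_lift << (a, m) >> = g a m.
Proof. by rewrite /freeg_lift liftU scale1r. Qed.

(** Universal property of the tensor product, relative to a subgroup [N]: a map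
that is bilinear and balanced only modulo [N] sends relations into [N].  This
stands for a map to the quotient of [V] by [N], without forming the quotient. *)
Lemma freeg_lift_rel (N : set V) :
  N 0 -> (forall u v, N u -> N v -> N (u - v)) ->
  (forall a b m, N (g (a + b) m - g a m - g b m)) ->
  (forall a m n, N (g a (m + n) - g a m - g a n)) ->
  (forall (r : R) a m, N (g ((r : R^c) *: a) m - g a (r *: m))) ->
  forall s, tensor_rel s -> N (freeg_lift s).
Proof.
move=> N0 NB NDl NDr NZ s; elim=> [|{}s t _ hs _ ht|a b m|a m n|r a m];
  rewrite ?freeg_liftB ?freeg_lift0 ?freeg_liftU //; exact: NB.
Qed.
End Lift.

End Tensors.

(** Phrased on representatives, flatness can be used and proved with the explicit
relations, with no reference to the quotients. *)
Lemma flat_kernelP (R : pzRingType) (M : lmodType R) :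
  flat M <->
  forall (A B : lmodType R^c) (f : {linear A -> B}) (s : {freeg (A * M)%type}),
    injective f -> tensor_rel (freeg_map f s) -> tensor_rel s.
Proof.
split=> [flM A B f s fI fs|ker A B f fI t u tu].
  apply/pi_tensor_eq0; apply: (flM _ _ _ fI).
  rewrite tensor_map_pi (pi_tensor_eq0 _).2 //.
  rewrite -(_ : \pi_(tensor A M) 0 = 0); last exact/pi_tensor_eq0/TensorRel0.
  rewrite tensor_map_pi; apply/esym/pi_tensor_eq0.
  by rewrite -(subrr 0) freeg_mapB subrr; exact: TensorRel0.
rewrite -[t]reprK -[u]reprK; apply/tensor_pi_eq; apply: ker fI _.
by rewrite freeg_mapB; apply/tensor_pi_eq.
Qed.

(** * Annihilators in flat modules *)

Section CyclicSubmodule.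
Variables (R : pzRingType) (G : seq R).

Local Notation colvec := ('I_(size G) -> (R^c : pzRingType)^o).
Local Notation gen i := (tnth (in_tuple G) i).

(** If g_1, ..., g_k are the entries of [G], this is the right submodule of R^k
generated by the column (g_1, ..., g_k), an embedded copy of R / r(G); flatness
is applied to its inclusion into R^k. *)
Definition cyclic_pred : {pred colvec} :=
  fun v => `[< exists c : R, forall i, v i = gen i * c >].

Lemma cyclic_submod_closed : submod_closed cyclic_pred.
Proof.
split=> [|r v w /asboolP[c vc] /asboolP[d wd]]; apply/asboolP.
  by exists 0 => i; rewrite mulr0.
by exists (c * r + d) => i; rewrite mulrDr mulrA -vc -wd.
Qed.

HB.instance Definition _ :=
  GRing.isSubmodClosed.Build R^c colvec cyclic_pred cyclic_submod_closed.

Record cyclic_submodule :=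
  Cyclic { cyclic_val :> colvec; _ : cyclic_val \in cyclic_pred }.

HB.instance Definition _ := [isSub for cyclic_val].
HB.instance Definition _ := [Choice of cyclic_submodule by <:].
HB.instance Definition _ := [SubChoice_isSubLmodule of cyclic_submodule by <:].

Lemma cyclic_multiplier (v : cyclic_submodule) : exists c : R, forall i, v i = gen i * c.
Proof. by case: v => v /= /asboolP. Qed.

(** With v0 = (g_1, ..., g_k) = sum_i e_i g_i, the tensor v0 (x) m becomes
sum_i e_i (x) g_i m = 0 in the tensor product of R^k with M.  By flatness it
vanishes over the cyclic submodule R / r(G), where it corresponds to the class
of m in M / r(G) M; and r(G) M <= M[U] since r(G) <= r(U). *)
Lemma flat_annihilated (M : lmodType R) (U : set R) : flat M ->
  rann [set` G] `<=` rann U ->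
  annihilated_by M [set` G] `<=` annihilated_by M U.
Proof.
move=> /flat_kernelP flM GU m Gm.
(* [w] inverts c |-> v0 c up to r(G); thus (v, n) |-> w v *: n is bilinear and
     balanced modulo M[U]. *)
have [w wP] := choice cyclic_multiplier.
have UG c n : (forall i, gen i * c = 0) -> annihilated_by M U (c *: n).
  move=> Gc u Uu; rewrite scalerA (GU c) ?scale0r // => g gG.
  have /tnthP[i ->] : g \in in_tuple G by [].
  exact: Gc.
have gP : (fun i => gen i) \in cyclic_pred.
  by apply/asboolP; exists 1 => i; rewrite mulr1.
pose v0 := Cyclic gP.
pose f : {linear cyclic_submodule -> colvec} := \val.
have rel0 : tensor_rel << (v0, m) >>.
  apply: (flM _ _ f); first exact: val_inj.
  rewrite freeg_mapU; apply/pi_tensor_eq0.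
  pose e i : colvec := fun j => (i == j)%:R.
  have -> : f v0 = \sum_i (gen i : R^c) *: e i.
    apply/funext => j; rewrite fct_sumE (bigD1 j) //= big1 ?addr0.
      by rewrite /e; change (gen j = (j == j)%:R * gen j); rewrite eqxx mul1r.
    move=> i /negbTE ij; change ((i == j)%:R * gen i = 0).
    by rewrite ij mul0r.
  rewrite -[LHS]/(tens _ m) tens_suml big1 // => i _.
  by rewrite tensZ Gm ?tens0r //= mem_tnth.
have : annihilated_by M U (w v0 *: m).
  rewrite -(freeg_liftU (fun v n => w v *: n)).
  apply: freeg_lift_rel rel0 => [r _|a b ha hb r Ur|a b n|a n p|r a n].
  - by rewrite scaler0.
  - by rewrite scalerBr ha // hb // subrr.
  - rewrite -!scalerBl; apply: UG => i; rewrite !mulrBr -!wP.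
    rewrite -[LHS]/(a i + b i - a i - b i).
    by rewrite [a i + _]addrC addrK subrr.
  - by move=> r _; rewrite [w a *: (n + p)]scalerDr [_ - _ - _]addrAC addrK subrr scaler0.
  - rewrite scalerA -!scalerBl; apply: UG => i.
    by rewrite !mulrBr mulrA -!wP; apply/eqP; rewrite subr_eq0.
move=> h r Ur.
have w1 i : gen i * (w v0 - 1) = 0 by rewrite mulrBr mulr1 -wP subrr.
have /eqP := UG _ m w1 r Ur.
by rewrite scalerBl scale1r scalerBr h // sub0r oppr_eq0 => /eqP.
Qed.

End CyclicSubmodule.

Lemma dcc_flat_semi_compact (R : pzRingType) (M : lmodType R) :
  dcc_right_annulets R -> flat M -> semi_compact M.
Proof.
move=> dcc flM; apply: finite_annihilators_semi_compact => U.
by have [G GU rG] := dcc_finite_rann U dcc; exists G => //; apply: flat_annihilated.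
Qed.

(** * Flatness of direct sums of copies of the ring *)

Section DirectSumFlat.
Variables (R : pzRingType) (Idx : choiceType).
Local Notation F := (direct_sum Idx R^o).

Lemma delta_finsupp (i : Idx) :
  (fun j => (j == i)%:R : R^o) \in @finsupp R Idx R^o.
Proof.
apply/asboolP; apply: (sub_finite_set _ (finite_set1 i)) => j /=.
by case: eqP.
Qed.

Definition delta (i : Idx) : F := DirectSum (delta_finsupp i).

Lemma dsumE (f g : F) (i : Idx) : (f + g) i = f i + g i.
Proof. by []. Qed.

Lemma dsumZ (r : R) (f : F) (i : Idx) : (r *: f) i = r * f i.
Proof. by []. Qed.

Lemma dsum_sumE J (s : seq J) (f : J -> F) (i : Idx) :
  (\sum_(j <- s) f j : F) i = \sum_(j <- s) f j i.
Proof. by elim: s => [|j s IH]; rewrite ?big_nil // !big_cons dsumE IH. Qed.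

(** The finite index set may be any sufficiently large one, so that expansions of
several elements can be brought to a common index set. *)
Lemma dsum_expand (f : F) : exists S : seq Idx,
  forall S', uniq S' -> {subset S <= S'} -> f = \sum_(i <- S') (f i : R) *: delta i.
Proof.
have /asboolP /finite_seqP[S SE] := valP f.
exists S => S' uS SS; apply: val_inj; apply/funext => j; rewrite /= dsum_sumE.
have [jS|jS] := boolP (j \in S'); last first.
  rewrite big_seq big1 => [|i iS].
    apply: contrapT => fj; move: jS; rewrite SS //.
    by have : [set` S] j by rewrite -SE.
  rewrite dsumZ /=; case: eqP jS => [->|_ _]; first by rewrite iS.
  by rewrite mulr0.
rewrite (bigD1_seq j) // big1 => [|i ij]; rewrite dsumZ /=.
  by rewrite eqxx mulr1 addr0.
by rewrite eq_sym (negbTE ij) mulr0.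
Qed.

(** The [i]-th coordinate of the isomorphism between the tensor product of A with
R^(Idx) and A^(Idx), on representatives. *)
Definition coord (A : lmodType R^c) (i : Idx) : {freeg (A * F)%type} -> A :=
  freeg_lift (fun a (f : F) => (f i : R^c) *: a).

Lemma coord_rel (A : lmodType R^c) (i : Idx) (s : {freeg (A * F)%type}) :
  tensor_rel s -> coord i s = 0.
Proof.
apply: (freeg_lift_rel (N := fun v => v = 0)) => // [u v -> ->|a b f|a f g|r a f].
- by rewrite subrr.
- by rewrite scalerDr addrAC addrK subrr.
- by rewrite dsumE scalerDl addrAC addrK subrr.
- by rewrite scalerA dsumZ; apply/eqP; rewrite subr_eq0.
Qed.

Lemma coord_map (A B : lmodType R^c) (f : {linear A -> B}) (i : Idx)
    (s : {freeg (A * F)%type}) :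
  coord i (freeg_map f s) = f (coord i s).
Proof.
elim/freeg_pure_ind: s => [|s t hs ht|a g].
- by rewrite -(subrr 0) freeg_mapB !subrr /coord !freeg_lift0 raddf0.
- by rewrite freeg_mapB /coord !freeg_liftB raddfB -!/(coord _ _) hs ht.
- by rewrite freeg_mapU /coord !freeg_liftU linearZ.
Qed.

(** Injectivity of the coordinates: a tensor is recovered from them. *)
Lemma coord_expand (A : lmodType R^c) (s : {freeg (A * F)%type}) :
  exists S : seq Idx, forall S', uniq S' -> {subset S <= S'} ->
    \pi_(tensor A F) s = \sum_(i <- S') tens (coord i s) (delta i).
Proof.
elim/freeg_pure_ind: s => [|s t [S hS] [T hT]|a g].
- exists [::] => S' _ _; rewrite big1 => [|i _].
    exact/pi_tensor_eq0/TensorRel0.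
  by rewrite /coord freeg_lift0 tens0l.
- exists (S ++ T) => S' uS ST.
  rewrite pi_tensorB (hS S') // ?(hT S') //.
  + rewrite -sumrB; apply: eq_bigr => i _.
    apply/eqP; rewrite subr_eq -tensDl /coord freeg_liftB.
    by rewrite subrK.
  + by move=> x xT; apply: ST; rewrite mem_cat xT orbT.
  + by move=> x xT; apply: ST; rewrite mem_cat xT.
- have [S hS] := dsum_expand g; exists S => S' uS SS.
  rewrite -[LHS]/(tens a g) {1}(hS S') // tens_sumr; apply: eq_bigr => i _.
  by rewrite -tensZ /coord freeg_liftU.
Qed.

Lemma direct_sum_flat : flat F.
Proof.
apply/flat_kernelP => A B f s fI fs; apply/pi_tensor_eq0.
have [S hS] := coord_expand s.
rewrite (hS (undup S)) ?undup_uniq //; last by move=> x; rewrite mem_undup.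
rewrite big1 // => i _.
have -> : coord i s = 0; last by rewrite tens0l.
by apply: fI; rewrite -coord_map raddf0; exact: coord_rel.
Qed.

End DirectSumFlat.

(** * Sigma-semi-compact rings *)

Lemma finite_set_nat_bound (F : set nat) :
  finite_set F -> exists N, forall n, F n -> (n <= N)%N.
Proof.
move=> /finite_seqP[s ->]; exists (\max_(n <- s) n) => n /= ns.
by rewrite (big_rem n) //= leq_maxl.
Qed.

Section Sigma.
Variable R : pzRingType.

Lemma truncate_finsupp (k : nat -> R) (n : nat) :
  (fun j => (if (j < n)%N then k j else 0) : R^o) \in @finsupp R nat R^o.
Proof.
apply/asboolP; apply: (sub_finite_set _ (finite_II n)) => j /=.
by case: ifP.
Qed.

Definition truncate k n : direct_sum nat R^o := DirectSum (truncate_finsupp k n).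

(** Truncations of one sequence k that chooses, wherever K_n = r(L_n) strictly
decreases, a witness in K_n outside K_(n+1).  Their differences beyond n lie in
K_n, hence are killed by L_n, so the system is finitely solvable. *)
Lemma sigma_semi_compact_acc :
  sigma_semi_compact (R^o : lmodType R) -> acc_left_annulets R.
Proof.
move=> ssc L La Lmon.
pose K n := rann (L n).
have Lle : {homo L : m n / (m <= n)%N >-> m `<=` n}.
  apply: homo_leq => [A|B A C|n]; [by []|exact: subset_trans|exact: Lmon].
have Kle m n : (m <= n)%N -> K n `<=` K m by move=> /Lle; exact: rann_anti.
have kex n : exists c, K n c /\ (K n.+1 c -> K n `<=` K n.+1).
  have [KK|/existsNP[c /not_implyP[Kc nKc]]] := pselect (K n `<=` K n.+1).
    by exists 0; split=> // r _; rewrite mulr0.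
  by exists c.
have [k kP] := choice kex.
have [|y yP] := ssc nat nat (truncate k) L (fun n => left_annulet_ideal (La n)).
  move=> F /finite_set_nat_bound[N hN].
  exists (truncate k N) => n /hN nN r Lr; apply: val_inj; apply/funext => j.
  change (r * ((if (j < N)%N then k j else 0) - (if (j < n)%N then k j else 0)) = 0).
  case: (ltnP j n) => [jn|nj]; first by rewrite (leq_trans jn nN) subrr mulr0.
  case: ifP => _; rewrite subr0 ?mulr0 //.
  by have [kj _] := kP j; apply: (Kle _ _ nj _ kj).
(* Beyond its support, the solution says that k_j lies in K_(j+1). *)
have /asboolP /finite_set_nat_bound[N hN] := valP y.
have Kst j : (N < j)%N -> K j `<=` K j.+1.
  move=> Nj; apply: (kP j).2 => r Lr.
  have := congr1 (fun f : direct_sum nat R^o => f j) (yP j.+1 r Lr).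
  change (r * (y j - (if (j < j.+1)%N then k j else 0)) = 0 -> r * k j = 0).
  rewrite ltnSn (_ : y j = 0) ?sub0r => [|]; last first.
    by apply: contrapT => /hN; rewrite leqNgt Nj.
  by rewrite mulrN => /eqP; rewrite oppr_eq0 => /eqP.
exists N.+1 => n Nn; rewrite -[LHS]lann_rannK // -[RHS]lann_rannK //.
congr lann; apply/seteqP; split; first exact: Kle.
rewrite -(subnKC Nn); elim: (n - _)%N => [|d IH]; first by rewrite addn0.
by rewrite addnS; move=> r /IH; apply: Kst; rewrite leq_addr.
Qed.

End Sigma.

Theorem theorem2p3 (R : pzRingType) :
  ((forall M : lmodType R, flat M -> semi_compact M) <->
     sigma_semi_compact (R^o : lmodType R)) /\
  (sigma_semi_compact (R^o : lmodType R) <-> acc_left_annulets R) /\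
  (acc_left_annulets R <-> dcc_right_annulets R).
Proof.
(* [direct_sum_flat] needs decidable equality on the index type, which the
     classical copy of [Idx] provides. *)
have flat_sigma : (forall M : lmodType R, flat M -> semi_compact M) ->
    sigma_semi_compact (R^o : lmodType R).
  by move=> h Idx; apply: h; exact: (@direct_sum_flat R {classic Idx}).
have acc_flat : acc_left_annulets R ->
    forall M : lmodType R, flat M -> semi_compact M.
  by move=> /acc_left_dcc_right dcc M; exact: dcc_flat_semi_compact.
have sigma_acc := @sigma_semi_compact_acc R.
split; first by split=> // /sigma_acc.
split; last exact: acc_left_dcc_right.
by split=> // /acc_flat.
Qed.
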